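(* For real numbers $C,R,L,U>0$ with $C<R+L$, let $F(C,L,R,U)$ denote the probability of failure in the mixed Nash equilibrium of the two-player Checker–Asserter game $\mathcal{G}_2$ with these parameters. Then $F$ is strictly increasing in the cost of checking $C$ (for fixed $L,R,U$, on the range $0<C<R+L$) and strictly decreasing in $U$ (for fixed $C,L,R$).
   Context: The game $\mathcal{G}_2$ is a one-shot simultaneous-move bimatrix game between a Checker (row player) with actions ''check'' and ''don't check'', and an Asserter (column player) with actions ''false'' and ''true'' (making a false or a true claim). The parameters are: $C$, the cost of checking; $R$, the Asserter's deposit (which is also the Checker's reward if a false claim is discovered); $L$, the Checker's loss if a false claim goes undetected; $U$, the Asserter's gain if a false claim goes undetected. The payoffs (Checker's payoff, Asserter's payoff) are: - (check, false): $(R-C,\,-R)$; - (check, true): $(-C,\,0)$; - (don't check, false): $(-L,\,U)$; - (don't check, true): $(0,\,0)$. A mixed strategy of the Checker is given by the probability $\alpha$ of playing ''check'', and a mixed strategy of the Asserter by the probability $\pi$ of playing ''false''. The mixed equilibrium is the Nash equilibrium in which $0<\alpha<1$ and $0<\pi<1$, so that each player is indifferent between its two actions. The probability of failure is the probability that, in this equilibrium, the Asserter makes a false claim and the Checker does not check: $F(C,L,R,U)=\pi(1-\alpha)$. *)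

(* Defs.v *)
From HB Require Import structures.
From mathcomp Require Import all_boot all_order all_algebra.
From mathcomp Require Import boolp classical_sets reals.

Set Implicit Arguments.
Unset Strict Implicit.
Unset Printing Implicit Defensive.

Import Order.TTheory GRing.Theory Num.Theory.

Local Open Scope ring_scope.

Inductive checker_action := check | dont_check.
Inductive asserter_action := claim_false | claim_true.

Definition checker_payoff (K : realType) (C L R : K)
    (a : checker_action) (b : asserter_action) : K :=
  match a, b with
  | check, claim_false => R - C
  | check, claim_true => - C
  | dont_check, claim_false => - L
  | dont_check, claim_true => 0
  end.

Definition asserter_payoff (K : realType) (R U : K)
    (a : checker_action) (b : asserter_action) : K :=
  match a, b with
  | check, claim_false => - R
  | check, claim_true => 0
  | dont_check, claim_false => U
  | dont_check, claim_true => 0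
  end.

(* Mixed strategies are represented by the probability alpha of [check] and
   the probability pi of [claim_false]. *)
Definition expected_payoff (K : realType)
    (u : checker_action -> asserter_action -> K) (alpha pi : K) : K :=
  alpha * pi * u check claim_false
  + alpha * (1 - pi) * u check claim_true
  + (1 - alpha) * pi * u dont_check claim_false
  + (1 - alpha) * (1 - pi) * u dont_check claim_true.

Definition nash_equilibrium (K : realType) (C L R U alpha pi : K) : Prop :=
  [/\ 0 <= alpha <= 1,
      0 <= pi <= 1,
      forall alpha' : K, 0 <= alpha' <= 1 ->
        expected_payoff (checker_payoff C L R) alpha' pi <=
        expected_payoff (checker_payoff C L R) alpha pi
    & forall pi' : K, 0 <= pi' <= 1 ->
        expected_payoff (asserter_payoff R U) alpha pi' <=
        expected_payoff (asserter_payoff R U) alpha pi].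

Definition mixed_equilibrium (K : realType) (C L R U alpha pi : K) : Prop :=
  [/\ nash_equilibrium C L R U alpha pi, 0 < alpha < 1 & 0 < pi < 1].

(* Value of pi * (1 - alpha) at a mixed equilibrium; the default 0 is returned
   only for parameters at which no mixed equilibrium exists. *)
Definition failure_probability (K : realType) (C L R U : K) : K :=
  xget 0 [set f | exists alpha pi : K,
            mixed_equilibrium C L R U alpha pi /\ f = pi * (1 - alpha)]%classic.

(* Main.v *)
(* In an interior equilibrium each player's payoff is affine in its own mixing
   probability with an interior maximum, so its slope vanishes. This gives
   pi (R + L) = C and alpha (R + U) = U, whence F = C R / ((R + L) (R + U)). *)

Require Import Defs.
From HB Require Import structures.
From mathcomp Require Import all_boot all_order all_algebra.
From mathcomp Require Import boolp classical_sets reals.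
From mathcomp Require Import ring.

Set Implicit Arguments.
Unset Strict Implicit.
Unset Printing Implicit Defensive.

Import Order.TTheory GRing.Theory Num.Theory.

Local Open Scope ring_scope.

(** Collected in the Checker's own variable [alpha]: the slope and the intercept depend only on the
    opponent's [pi]. *)
Lemma checker_payoffE (K : realType) (C L R alpha pi : K) :
  expected_payoff (checker_payoff C L R) alpha pi =
  alpha * (pi * (R + L) - C) - pi * L.
Proof. by rewrite /expected_payoff /=; ring. Qed.

Lemma asserter_payoffE (K : realType) (R U alpha pi : K) :
  expected_payoff (asserter_payoff R U) alpha pi =
  pi * (U - alpha * (R + U)).
Proof. by rewrite /expected_payoff /=; ring. Qed.

(** Testing the two endpoints suffices: [y = 0] gives [0 <= x * m], and [y = 1] gives
    [(1 - x) * m <= 0], where [x] and [1 - x] are positive. *)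
Lemma interior_max_slope0 (K : numDomainType) (m b x : K) : 0 < x < 1 ->
  (forall y, 0 <= y <= 1 -> y * m + b <= x * m + b) -> m = 0.
Proof.
move=> /andP[x0 x1] xmax.
have := xmax 0; rewrite lexx ler01 => /(_ isT).
have := xmax 1; rewrite lexx ler01 => /(_ isT).
rewrite !lerD2r mul1r mul0r => lem; rewrite pmulr_rge0 // => m0.
apply/eqP; rewrite eq_le m0 andbT -(@pmulr_rle0 _ (1 - x)) ?subr_gt0 //.
by rewrite mulrBl mul1r subr_le0.
Qed.

Lemma mixed_equilibriumP (K : realType) (C L R U alpha pi : K) :
  0 < C -> 0 < R -> 0 < U -> C < R + L ->
  mixed_equilibrium C L R U alpha pi <->
  alpha = U / (R + U) /\ pi = C / (R + L).
Proof.
move=> C0 R0 U0 CRL.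
have RL0 : 0 < R + L by exact: lt_trans CRL.
have RU0 : 0 < R + U by exact: addr_gt0.
split.
  move=> [[_ _ amax pmax] a01 p01]; split.
    (* The roles cross: the Asserter's optimality determines the Checker's [alpha], and below the
       Checker's optimality determines [pi]. *)
    apply: (canRL (mulfK (lt0r_neq0 RU0))); apply/esym/eqP; rewrite -subr_eq0.
    apply/eqP/(interior_max_slope0 (b := 0) p01) => y y01.
    by have := pmax y y01; rewrite !asserter_payoffE !addr0.
  apply: (canRL (mulfK (lt0r_neq0 RL0))); apply/eqP; rewrite -subr_eq0.
  apply/eqP/(interior_max_slope0 (b := - (pi * L)) a01) => y y01.
  by have := amax y y01; rewrite !checker_payoffE.
move=> [-> ->].
have a01 : 0 < U / (R + U) < 1.
  by rewrite divr_gt0 //= ltr_pdivrMr // mul1r ltrDr.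
(* The bound by 1 is exactly [C < R + L]. *)
have p01 : 0 < C / (R + L) < 1.
  by rewrite divr_gt0 //= ltr_pdivrMr // mul1r.
split=> //; split.
- by case/andP: a01 => /ltW -> /ltW ->.
- by case/andP: p01 => /ltW -> /ltW ->.
(* At these values both slopes vanish, so every unilateral deviation yields an equal payoff. *)
- by move=> y _; rewrite !checker_payoffE divfK ?gt_eqF // subrr !mulr0.
- by move=> y _; rewrite !asserter_payoffE divfK ?gt_eqF // subrr !mulr0.
Qed.

(** Uniqueness of the equilibrium excludes the default value of [xget]. The product form isolates
    [C] in the first factor and [U] in the second, so each monotonicity claim concerns a single
    factor. *)
Lemma failure_probabilityE (K : realType) (C L R U : K) :
  0 < C -> 0 < R -> 0 < U -> C < R + L ->
  failure_probability C L R U = C / (R + L) * (R / (R + U)).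
Proof.
move=> C0 R0 U0 CRL.
have RU0 : R + U != 0 by rewrite gt_eqF // addr_gt0.
have compl : 1 - U / (R + U) = R / (R + U) by field.
rewrite /failure_probability; apply: xget_unique.
  exists (U / (R + U)), (C / (R + L)); rewrite compl; split=> //.
  exact/mixed_equilibriumP.
move=> f [alpha [pi [/mixed_equilibriumP[] // -> -> ->]]].
by rewrite compl.
Qed.

Theorem proposition1 (K : realType) :
  (forall C L R U : K, 0 < C -> 0 < L -> 0 < R -> 0 < U -> C < R + L ->
     exists! s : K * K, mixed_equilibrium C L R U s.1 s.2) /\
  (forall L R U : K, 0 < L -> 0 < R -> 0 < U ->
     forall C1 C2 : K, 0 < C1 -> C1 < C2 -> C2 < R + L ->
     failure_probability C1 L R U < failure_probability C2 L R U) /\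
  (forall C L R : K, 0 < C -> 0 < L -> 0 < R -> C < R + L ->
     forall U1 U2 : K, 0 < U1 -> U1 < U2 ->
     failure_probability C L R U2 < failure_probability C L R U1).
Proof.
split; [|split].
(* This clause ensures that the two comparisons concern a genuine equilibrium value. *)
- move=> C L R U C0 L0 R0 U0 CRL; exists (U / (R + U), C / (R + L)); split.
    exact/mixed_equilibriumP.
  by move=> [alpha pi] /mixed_equilibriumP[] //= -> ->.
- move=> L R U L0 R0 U0 C1 C2 C10 C12 C2RL.
  have C20 := lt_trans C10 C12; have C1RL := lt_trans C12 C2RL.
  rewrite !failure_probabilityE //.
  by rewrite ltr_pM2r ?ltr_pM2r ?invr_gt0 ?divr_gt0 ?addr_gt0.
- move=> C L R C0 L0 R0 CRL U1 U2 U10 U12.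
  have U20 := lt_trans U10 U12.
  rewrite !failure_probabilityE // ltr_pM2l ?divr_gt0 ?addr_gt0 //.
  by rewrite ltr_pM2l // ltf_pV2 ?posrE ?addr_gt0 // ltrD2l.
Qed.
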